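(* Let $T$ be a tree of bounded degree in which every vertex has degree greater than $2$. Then $T$ admits a harmonic labeling, i.e. there is a bijection $\phi:V(T)\to\mathbb{Z}$ such that $\phi(x)=\frac{1}{\deg(x)}\sum_{y\sim x}\phi(y)$ for every vertex $x$.
   Context: For a graph $G=(V,E)$ in which every vertex has finite degree, a function $\phi:V\to\mathbb{Z}$ is harmonic if $\phi(x)=\frac{1}{\deg(x)}\sum_{y\sim x}\phi(y)$ for all $x\in V$, where the sum is over the neighbours $y$ of $x$. A harmonic labeling of $G$ is a harmonic function $\phi:V\to\mathbb{Z}$ that is injective and surjective onto $\mathbb{Z}$. *)

(* Defs.v *)
From mathcomp Require Import all_boot all_order all_algebra.
From mathcomp Require Import finmap.
From mathcomp Require Import boolp classical_sets functions cardinality fsbigop.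

Set Implicit Arguments.
Unset Strict Implicit.
Unset Printing Implicit Defensive.

Import Order.TTheory GRing.Theory Num.Theory.
Local Open Scope classical_set_scope.
Local Open Scope ring_scope.

Record graph := Graph {
  vertex :> choiceType;
  adj : rel vertex;
  adj_sym : symmetric adj;
  adj_irr : irreflexive adj
}.

Section GraphNotions.
Variable G : graph.

Definition neighbours (x : G) : set G := [set y | adj x y].

Definition locally_finite : Prop := forall x : G, finite_set (neighbours x).

(* Meaningful only when neighbours x is finite: fset_set sends an infinite set
   to the empty finite set. *)
Definition degree (x : G) : nat := #|` fset_set (neighbours x)|.

Definition bounded_degree : Prop :=
  locally_finite /\ exists d : nat, forall x : G, (degree x <= d)%N.

(* The empty graph is excluded, so that it does not count as a tree. *)
Definition connected_graph : Prop :=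
  (exists x : G, True) /\
  forall x y : G, exists2 p : seq G, path (@adj G) x p & last x p = y.

(* The bound on the size is needed: adjacent x, y give ucycle adj [:: x; y],
   and ucycle adj [::] always holds. *)
Definition acyclic_graph : Prop :=
  forall c : seq G, (3 <= size c)%N -> ~ ucycle (@adj G) c.

Definition tree : Prop := connected_graph /\ acyclic_graph.

Definition harmonic (phi : G -> int) : Prop :=
  forall x : G,
    (phi x)%:Q = (degree x)%:Q^-1 * \sum_(y \in neighbours x) (phi y)%:Q.

Definition harmonic_labeling (phi : G -> int) : Prop :=
  [/\ harmonic phi, injective phi & forall n : int, exists x : G, phi x = n].

End GraphNotions.

(* Main.v *)
Require Import Defs.
From mathcomp Require Import all_boot all_order all_algebra.
From mathcomp Require Import finmap.
From mathcomp Require Import boolp classical_sets functions cardinality fsbigop.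
From mathcomp Require Import zify.

(* Root the tree and label finite parent-closed subtrees injectively, keeping
   the equation at every vertex whose children are labelled, and labelling the
   children of a vertex all at once.  The children of a labelled vertex x must
   have a prescribed sum; since there are at least two, their labels can be
   chosen distinct and outside any finite set.  To reach a given integer n, give
   one child y of a deepest labelled x a very large label A and label one child
   of y by n: the other children of y then have sum deg(y) A - phi(x) - n, which
   is too large to be a label already used, even when there is only one of them.
   Alternating between labelling the children of all labelled vertices and
   reaching the next integer gives the labeling in the limit. *)

Set Implicit Arguments.
Unset Strict Implicit.
Unset Printing Implicit Defensive.

Import Order.TTheory GRing.Theory Num.Theory.
Local Open Scope ring_scope.

(** * Integer lists with prescribed sum and forbidden values *)

Lemma norm_le_sum (F : seq int) (l : int) :
  l \in F -> `|l| <= \sum_(m <- F) `|m|.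
Proof.
elim: F => // a F IH; rewrite inE big_cons => /orP[/eqP->|/IH h].
  by rewrite lerDl sumr_ge0.
by rewrite (le_trans h) // lerDr.
Qed.

(** Induction on [k]: split off an entry [A] so large that neither [A] nor the remaining sum [c - A]
    lies in [F], then forbid [A] too. For [k = 0] the only entry is forced to be [c]. *)
Lemma exists_avoiding_sum (k : nat) (c : int) (F : seq int) :
    (k = 0%N -> c \notin F) ->
  exists v : seq int, [/\ size v = k.+1, uniq v,
    forall a, a \in v -> a \notin F & \sum_(a <- v) a = c].
Proof.
elim: k c F => [|k IH] c F hc.
  exists [:: c]; split=> //; last by rewrite big_seq1.
  by move=> a; rewrite inE => /eqP->; apply: hc.
set S := \sum_(m <- F) `|m|.
have S0 : 0 <= S by apply: sumr_ge0.
pose A := 1 + `|c| + S.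
have hF l : l \in F -> `|l| <= S by apply: norm_le_sum.
have AF : A \notin F by apply/negP => /hF; rewrite /A; lia.
have cA : c - A \notin A :: F.
  rewrite inE negb_or; apply/andP; split; first by apply/eqP; rewrite /A; lia.
  by apply/negP => /hF; rewrite /A; lia.
have [v [v1 v2 v3 v4]] := IH (c - A) (A :: F) (fun _ => cA).
exists (A :: v); split => /=.
- by rewrite v1.
- by rewrite v2 andbT; apply/negP => /v3; rewrite inE eqxx.
- move=> a; rewrite inE => /orP[/eqP->//|/v3]; by rewrite inE negb_or => /andP[].
- by rewrite big_cons v4 addrC subrK.
Qed.

(* In [hit_value], [A] and [n] label a child and a grandchild of a vertex labelled
   [p]; [D * A - p - n] is what remains for the other grandchildren and [c - A]
   for the other children. *)
Lemma exists_large_value (D : nat) (c p n : int) (F : seq int) :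
    (2 < D)%N ->
  exists A : int, [/\ A \notin n :: F, D%:Z * A - p - n \notin A :: n :: F &
    c - A \notin A :: (D%:Z * A - p - n) :: n :: F].
Proof.
move=> D3.
set S := \sum_(m <- F) `|m|.
have S0 : 0 <= S by apply: sumr_ge0.
(* This makes [A > S], [c - A < - S] and, as [D >= 3], [D * A - p - n > A]; the terms in [n] keep
   all three away from [n]. *)
pose A := 1 + `|c| + `|p| + 2 * `|n| + S.
have hF l : l \in F -> `|l| <= S by apply: norm_le_sum.
have A0 : 0 <= A by rewrite /A; lia.
have hB : 3 * A <= D%:Z * A by rewrite ler_wpM2r.
exists A; move: (D%:Z * A) hB => B hB.
have out l : S < `|l| -> l \notin F by move=> h; apply/negP => /hF; lia.
split; rewrite !inE !negb_or.
- by rewrite out ?andbT; rewrite /A; lia.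
- by rewrite out ?andbT; rewrite /A in hB *; lia.
- by rewrite out ?andbT; rewrite /A in hB *; lia.
Qed.

Lemma exists_seq_max (T : eqType) (d : T -> nat) (s : seq T) (x0 : T) :
  x0 \in s -> exists2 x, x \in s & forall y, y \in s -> (d y <= d x)%N.
Proof.
elim: s x0 => // a [|b s] IH x0 _.
  by exists a; rewrite ?inE // => y; rewrite inE => /eqP->.
have [x xs hx] := IH b (mem_head _ _).
case: (leqP (d a) (d x)) => h.
  by exists x; [rewrite inE xs orbT | move=> y; rewrite inE => /orP[/eqP->|/hx]].
exists a; first exact: mem_head.
move=> y; rewrite inE => /orP[/eqP->//|/hx hy].
exact: leq_trans hy (ltnW h).
Qed.

(** * Rooting a tree *)

(** [depth] is the distance to a chosen [r], and [par] picks a neighbour nearer to [r]; [par r] is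
    arbitrary. *)
Lemma tree_rooting (T : graph) : tree T ->
  exists (r : T) (par : T -> T) (depth : T -> nat),
  [/\ forall x, x != r -> (depth (par x) < depth x)%N
    & forall x y, adj x y =
        (x != r) && (par x == y) || (y != r) && (par y == x)].
Proof.
move=> [[[r _] conn] acyc].
pose P x n := `[< exists2 p, path (@adj T) x p /\ last x p = r & size p = n >].
have exP x : exists n, P x n.
  by have [p hp hl] := conn x r; exists (size p); apply/asboolP; exists p.
pose depth x := ex_minn (exP x).
have ex_par x : exists y, x != r -> adj x y && (depth y < depth x)%N.
  case: (eqVneq x r) => [_|xr]; first by exists x.
  rewrite {2}/depth; case: ex_minnP => n /asboolP[[|y p] /= [hp hl] <-] _.
    by rewrite hl eqxx in xr.
  move/andP: hp => [xy hp]; exists y => _; rewrite xy ltnS /depth.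
  case: ex_minnP => m _; apply; apply/asboolP; by exists p.
have [par hpar] := choice ex_par.
exists r, par, depth; split=> [x /hpar/andP[]//|x y].
pose e : rel T := fun x y => (x != r) && (par x == y) || (y != r) && (par y == x).
rewrite -[RHS]/(e x y).
(* The tree edges [e] already connect [x] to [y], so an edge [xy] outside [e]
   would close a cycle. *)
have esub : subrel e (@adj T).
  move=> a b /orP[]/andP[/hpar/andP[h _] /eqP <-] //; by rewrite adj_sym.
have esym a b : e a b = e b a by rewrite /e orbC.
apply/idP/idP => [xy|]; last exact: esub.
have to_root a : exists2 p, path e a p & last a p = r.
  have [n] := ubnP (depth a); elim: n a => // n IH a hn.
  case: (eqVneq a r) => [->|ar]; first by exists [::].
  have /andP[_ lt] := hpar _ ar.
  have [p hp hl] := IH _ (leq_trans lt hn).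
  by exists (par a :: p) => //=; rewrite hp /e ar eqxx.
have [p hp hl] : exists2 p, path e x p & last x p = y.
  have [p hp hl] := to_root x; have [q hq hm] := to_root y.
  (* Go from [x] up to [r], then back along the reversed path from [y]. *)
  exists (p ++ rev (belast y q)).
    rewrite cat_path hp hl -hm rev_path.
    by rewrite (eq_path (e' := e)) // => a b; rewrite esym.
  rewrite last_cat hl -hm; case: q {hq hm} => //= b q.
  by rewrite rev_cons last_rcons.
case/shortenP: hp hl => q hq uq _ hl.
apply: contrapT => nexy; apply: (acyc (x :: q)).
  (* The cycle has at least three vertices: an empty [q] would make [xy] a loop, and a single vertex
     would put [xy] in [e]. *)
  case: q hq hl {uq} => [|a [|b q]] //= => [_ xe|].
    by rewrite xe adj_irr in xy.
  by rewrite andbT => xa ay; rewrite ay in xa.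
by rewrite /ucycle uq andbT /cycle rcons_path (sub_path esub hq) hl adj_sym.
Qed.

(** * Injective labelings of finite subtrees *)

Section PartialLabelings.
Variables (T : eqType) (r : T) (par : T -> T) (depth : T -> nat).
Variable ch : T -> seq T.
Hypothesis depth_par : forall x, x != r -> (depth (par x) < depth x)%N.
Hypothesis ch_uniq : forall x, uniq (ch x).
Hypothesis mem_ch : forall x y, (y \in ch x) = (y != r) && (par y == x).

Definition tree_degree (x : T) : nat := (size (ch x) + (x != r))%N.

Hypothesis degree_gt2 : forall x, (2 < tree_degree x)%N.

(** The sum that harmonicity at [x] imposes on the children; the boolean factor removes the
    meaningless parent term at the root. *)
Definition child_sum (f : T -> int) (x : T) : int :=
  (tree_degree x)%:Z * f x - (x != r)%:Z * f (par x).

Definition balanced (f : T -> int) (x : T) : Prop :=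
  \sum_(y <- ch x) f y = child_sum f x.

Definition childless (s : seq T) (x : T) : Prop :=
  forall y, y \in ch x -> y \notin s.

Definition complete (st : seq T * (T -> int)) (x : T) : Prop :=
  {subset ch x <= st.1} /\ balanced st.2 x.

(* Only the values of [st.2] on [st.1] are meaningful. *)
Record partial_labeling (st : seq T * (T -> int)) : Prop := PartialLabeling {
  root_in : r \in st.1;
  par_in : forall x, x \in st.1 -> x != r -> par x \in st.1;
  label_inj : {in st.1 &, injective st.2};
  complete_or_childless :
    forall x, x \in st.1 -> complete st x \/ childless st.1 x
}.

Definition extends (st st' : seq T * (T -> int)) : Prop :=
  {subset st.1 <= st'.1} /\ {in st.1, st'.2 =1 st.2}.

Lemma extends_refl st : extends st st.
Proof. by split. Qed.

Lemma extends_trans st2 st1 st3 :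
  extends st1 st2 -> extends st2 st3 -> extends st1 st3.
Proof.
move=> [s1 e1] [s2 e2]; split=> x xs; first by apply: s2; apply: s1.
by rewrite e2 ?e1 ?s1.
Qed.

Lemma par_neq x : x != r -> par x != x.
Proof. by move=> /depth_par; apply: contraTneq => ->; rewrite ltnn. Qed.

(** Balance at [x] involves only [x], its children and its parent, all labelled in [st] already. *)
Lemma complete_extends st st' x :
    partial_labeling st -> x \in st.1 -> extends st st' ->
  complete st x -> complete st' x.
Proof.
move=> Pst xs [sub feq] [c1 c2]; split; first by move=> y /c1/sub.
rewrite /balanced big_seq (eq_bigr st.2) => [|y /c1/feq//].
rewrite -big_seq c2 /child_sum feq //.
case: eqVneq => [|xr]; first by rewrite !mul0r.
by rewrite feq //; apply: par_in.
Qed.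

(** The basic move: the children of [x] receive the labels [v], in order, and become the new
    leaves. *)
Lemma expand st x (v : seq int) :
    partial_labeling st -> x \in st.1 -> childless st.1 x ->
    size v = size (ch x) -> uniq v ->
    (forall a, a \in v -> a \notin map st.2 st.1) ->
    \sum_(a <- v) a = child_sum st.2 x ->
  exists st', [/\ partial_labeling st', extends st st',
    st'.1 = ch x ++ st.1, map st'.2 (ch x) = v
    & forall y, y \in ch x -> childless st'.1 y].
Proof.
move=> Pst xs cx sv uv dv sumv.
pose f y := if y \in ch x then nth 0 v (index y (ch x)) else st.2 y.
have fch : map f (ch x) = v.
  apply: (eq_from_nth (x0 := 0)); rewrite size_map // => i hi.
  by rewrite (nth_map x) // /f mem_nth // index_uniq.
have fold y : y \in st.1 -> f y = st.2 y.
  by move=> ys; rewrite /f; case: ifP => // /cx; rewrite ys.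
have fnew y : y \in ch x -> f y \in v by move=> h; rewrite -fch map_f.
have fsep y z : y \in ch x -> z \in st.1 -> f y <> f z.
  move=> yc zs eq; have := dv _ (fnew _ yc).
  by rewrite eq fold // map_f.
have ext : extends st (ch x ++ st.1, f).
  by split=> [y ys|y /fold//]; rewrite mem_cat ys orbT.
(* A child [z] of [y] is not a child of [x], which would give [y = x], nor in [st.1], which would
   then contain its parent [y]. *)
have new y : y \in ch x -> childless (ch x ++ st.1) y.
  move=> yx z; rewrite mem_ch => /andP[zr /eqP zy]; rewrite mem_cat.
  apply/negP => /orP[|zs].
    rewrite mem_ch zr zy /= => /eqP yE; move: yx; rewrite yE mem_ch.
    by move=> /andP[/par_neq/eqP h /eqP].
  by have := par_in Pst zs zr; rewrite zy (negPf (cx _ yx)).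
exists (ch x ++ st.1, f); split=> //; split=> /=.
- by rewrite mem_cat (root_in Pst) orbT.
- move=> y; rewrite !mem_cat => /orP[|ys yr].
    by rewrite mem_ch => /andP[_ /eqP->]; rewrite xs orbT.
  by rewrite (par_in Pst) ?orbT.
- move=> y z; rewrite !mem_cat => /orP[yc|ys] /orP[zc|zs] eq.
  + move: eq; rewrite /f yc zc => /eqP; rewrite nth_uniq ?sv ?index_mem //.
    by move=> /eqP eq; rewrite -(nth_index x yc) eq nth_index.
  + by case: (fsep _ _ yc zs).
  + by case: (fsep _ _ zc ys).
  + by apply: (label_inj Pst); rewrite // -!fold.
- move=> y; rewrite mem_cat => /orP[/new|ys]; first by right.
  case: (complete_or_childless Pst ys) => [c|nc].
    by left; apply: complete_extends Pst ys ext c.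
  case: (eqVneq y x) => [->|yx].
    left; split; first by move=> z zc; rewrite /= mem_cat zc.
    rewrite /balanced /= -(big_map f predT (fun a => a)) fch sumv.
    rewrite /child_sum fold //; case: eqVneq => [|xr]; first by rewrite !mul0r.
    by rewrite fold //; exact: (par_in Pst xs).
  right=> z zy; rewrite mem_cat negb_or nc // andbT.
  move: zy; rewrite !mem_ch => /andP[-> /eqP->] /=; exact: yx.
Qed.

Lemma size_ch_gt1 x : (1 < size (ch x))%N.
Proof. by have := degree_gt2 x; rewrite /tree_degree; case: (x != r); lia. Qed.

Lemma complete_vertex st x : partial_labeling st -> x \in st.1 ->
  exists st', [/\ partial_labeling st', extends st st' & {subset ch x <= st'.1}].
Proof.
move=> Pst xs; case: (complete_or_childless Pst xs) => [[c _]|cx].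
  by exists st; split=> //; apply: extends_refl.
have := size_ch_gt1 x; case E : (size (ch x)) => [|[|k]] // _.
(* With at least two children, the condition for a single entry is vacuous. *)
have [//|v [v1 v2 v3 v4]] :=
  @exists_avoiding_sum k.+1 (child_sum st.2 x) (map st.2 st.1).
have [] := expand Pst xs cx _ v2 v3 v4; first by rewrite v1 E.
move=> st' [P' ext E' _ _]; exists st'; split=> // y yc.
by rewrite E' mem_cat yc.
Qed.

Lemma hit_value st (n : int) : partial_labeling st ->
  exists st', [/\ partial_labeling st', extends st st' & n \in map st'.2 st'.1].
Proof.
move=> Pst; case: (boolP (n \in map st.2 st.1)) => [hn|nF].
  by exists st; split=> //; apply: extends_refl.
set F := map st.2 st.1 in nF.
have [x xs hx] := exists_seq_max depth (root_in Pst).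
have cx : childless st.1 x.
  move=> y; rewrite mem_ch => /andP[yr /eqP yx]; apply/negP => /hx.
  by rewrite leqNgt -yx depth_par.
have := size_ch_gt1 x; case E : (ch x) => [|y [|y' q]] // _.
have yc : y \in ch x by rewrite E mem_head.
have /andP[yr /eqP yx] : (y != r) && (par y == x) by rewrite -mem_ch.
have [A [A1 A2 A3]] :=
  exists_large_value (child_sum st.2 x) (st.2 x) n F (degree_gt2 y).
set B := _ - n in A2 A3.
(* [w] labels the siblings of [y], keeping [B] and [n] free for the children of [y]; [A3] covers the
   case of one sibling. *)
have [//|w [w1 w2 w3 w4]] := @exists_avoiding_sum (size q)
  (child_sum st.2 x - A) (A :: B :: n :: F).
have wA a : a \in w -> [/\ a != A, a != B, a != n & a \notin F].
  by move=> /w3; rewrite !inE !negb_or => /and4P.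
have [||||st1 [P1 ext1 E1 f1 c1]] := expand (v := A :: w) Pst xs cx.
- by rewrite E /= w1.
- by rewrite /= w2 andbT; apply/negP => /wA[]; rewrite eqxx.
- move=> a; rewrite inE => /orP[/eqP->|/wA[]//].
  by move: A1; rewrite inE negb_or => /andP[].
- by rewrite big_cons w4 addrC subrK.
have ys1 : y \in st1.1 by rewrite E1 mem_cat yc.
have fy : st1.2 y = A by move: f1; rewrite E /= => -[].
have fx : st1.2 x = st.2 x by apply: ext1.2.
have F1 : map st1.2 st1.1 = (A :: w) ++ F.
  by rewrite E1 map_cat f1; congr (_ ++ _); apply/eq_in_map/ext1.2.
have nF1 : n \notin (A :: w) ++ F.
  rewrite mem_cat inE !negb_or nF andbT; apply/andP; split.
    by move: A1; rewrite inE negb_or eq_sym => /andP[].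
  by apply/negP => /wA[_ _]; rewrite eqxx.
have BF1 : B \notin n :: (A :: w) ++ F.
  move: A2; rewrite !inE !mem_cat !negb_or => /and3P[-> -> ->]; rewrite !andbT.
  by apply/negP => /wA[_]; rewrite eqxx.
(* Once one child of [y] gets [n], the others must sum to [B], which is admissible even for a single
   one. *)
have cB : child_sum st1.2 y - n = B.
  by rewrite /child_sum fy yx fx yr mul1r.
have := size_ch_gt1 y; case E2 : (size (ch y)) => [|[|k]] // _.
have [_|v [v1 v2 v3 v4]] := @exists_avoiding_sum k
  (child_sum st1.2 y - n) (n :: (A :: w) ++ F); first by rewrite cB.
have [||||st2 [P2 ext2 E3 f2 _]] := expand (v := n :: v) P1 ys1 (c1 y yc).
- by rewrite E2 /= v1.
- by rewrite /= v2 andbT; apply/negP => /v3; rewrite mem_head.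
- move=> a; rewrite F1 inE => /orP[/eqP->//|/v3].
  by rewrite inE negb_or => /andP[].
- by rewrite big_cons v4 addrC subrK.
exists st2; split=> //; first exact: extends_trans ext2.
by rewrite E3 map_cat f2 mem_cat mem_head.
Qed.

(** The list [s] stays fixed while [st.1] grows during the induction. *)
Lemma complete_all st (s : seq T) : partial_labeling st -> {subset s <= st.1} ->
  exists st', [/\ partial_labeling st', extends st st'
    & forall x, x \in s -> {subset ch x <= st'.1}].
Proof.
elim: s st => [|x s IH] st Pst sub.
  by exists st; split=> //; apply: extends_refl.
have [st1 [P1 e1 c1]] := complete_vertex Pst (sub x (mem_head _ _)).
have [|st2 [P2 e2 c2]] := IH st1 P1.
  by move=> y ys; apply/e1.1/sub; rewrite inE ys orbT.
exists st2; split=> //; first exact: extends_trans e2.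
by move=> y; rewrite inE => /orP[/eqP-> z /c1/e2.1|/c2].
Qed.

(** * The limit labeling *)

Lemma exists_balanced_bijection : exists phi : T -> int,
  [/\ forall x, balanced phi x, injective phi & forall n, exists x, phi x = n].
Proof.
pose state := {st : seq T * (T -> int) | partial_labeling st}.
have step (p : int * state) : exists st' : state,
    [/\ extends (sval p.2) (sval st'),
        forall x, x \in (sval p.2).1 -> {subset ch x <= (sval st').1}
      & p.1 \in map (sval st').2 (sval st').1].
  case: p => n [st Pst] /=.
  have [st1 [P1 e1 c1]] := complete_all Pst (fun x (h : x \in st.1) => h).
  have [st2 [P2 e2 h2]] := hit_value n P1.
  exists (exist _ st2 P2); split=> //=; first exact: extends_trans e2.
  by move=> x /c1 c y /c/e2.1.
have [next hnext] := choice step.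
have P0 : partial_labeling ([:: r], fun=> 0).
  split=> /=; first exact: mem_head.
  - by move=> x; rewrite inE => /eqP->; rewrite eqxx.
  - by move=> x y; rewrite !inE => /eqP-> /eqP->.
  - move=> x _; right=> y; rewrite mem_ch inE => /andP[].
    by [].
(* Every integer is the target of its own code; the default 0 at other indices is harmless. *)
pose target m : int := odflt 0 (choice.unpickle m).
pose st := fix st n : state :=
  if n is m.+1 then next (target m, st m) else exist _ _ P0.
have Pst n : partial_labeling (sval (st n)) := svalP (st n).
have ext m n : (m <= n)%N -> extends (sval (st m)) (sval (st n)).
  elim: n => [|n IH]; first by rewrite leqn0 => /eqP->; apply: extends_refl.
  rewrite leq_eqVlt => /orP[/eqP->|/IH h]; first exact: extends_refl.
  by have [e _ _] := hnext (target n, st n); apply: (extends_trans h).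
(* Each round labels all children of labelled vertices, so stage [n] reaches depth [n]. *)
have cover n x : (depth x <= n)%N -> x \in (sval (st n)).1.
  elim: n x => [|n IH] x hx; (case: (eqVneq x r) => [->|xr];
    [exact: root_in|have lt := depth_par xr]).
    by move: (leq_trans lt hx).
  have pin : par x \in (sval (st n)).1 by apply/IH; rewrite -ltnS (leq_trans lt).
  have [_ c _] := hnext (target n, st n).
  by apply: (c _ pin); rewrite mem_ch xr /=.
pose phi x := (sval (st (depth x))).2 x.
have phiE n x : x \in (sval (st n)).1 -> phi x = (sval (st n)).2 x.
  move=> xs; case: (leqP n (depth x)) => h; first exact: (ext _ _ h).2.
  by symmetry; apply: (ext _ _ (ltnW h)).2; apply: cover.
exists phi; split.
- move=> x; set n := (depth x).+1.
  have xs : x \in (sval (st n)).1 by apply: cover; rewrite leqW.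
  have [c|nc] := complete_or_childless (Pst n) xs.
    (* [phi] agrees with stage [n] on its vertices, so it inherits balance from it. *)
    have e : extends (sval (st n)) ((sval (st n)).1, phi).
      by split=> // y /phiE.
    by have [_] := complete_extends (Pst n) xs e c.
  (* [x] cannot be childless here: it was labelled one stage earlier, so this stage contains its
     children. *)
  have := size_ch_gt1 x; case E : (ch x) => [//|y q] _.
  have yc : y \in ch x by rewrite E mem_head.
  have [_ c _] := hnext (target (depth x), st (depth x)).
  by have := nc y yc; rewrite (c x (cover _ _ (leqnn _)) y yc).
- move=> x y; pose n := maxn (depth x) (depth y).
  have xs : x \in (sval (st n)).1 by rewrite cover // leq_maxl.
  have ys : y \in (sval (st n)).1 by rewrite cover // leq_maxr.
  by rewrite (phiE n) // (phiE n y) //; apply: (label_inj (Pst n)).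
- move=> k; pose m := choice.pickle k.
  have [_ _] := hnext (target m, st m).
  rewrite /= /target choice.pickleK /= => /mapP[x xs ->]; exists x.
  by rewrite (phiE m.+1) //= /target choice.pickleK.
Qed.

End PartialLabelings.

(** * From balance on the rooted tree to harmonicity *)

Theorem theorem2 (T : graph) (T_tree : tree T) (T_bounded : bounded_degree T)
    (T_deg : forall x : T, (2 < degree x)%N) :
  exists phi : T -> int, harmonic_labeling phi.
Proof.
have [lf _] := T_bounded.
have [r [par [depth [dpar adjE]]]] := tree_rooting T_tree.
pose N (x : T) : seq T := enum_fset (fset_set (neighbours x)).
have memN x y : (y \in N x) = adj x y.
  rewrite [LHS](_ : _ = (y \in fset_set (neighbours x))) // in_fset_set //.
  by apply/idP/idP => h; rewrite inE in h *.
pose ch (x : T) := [seq y <- N x | (y != r) && (par y == x)].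
have ch_uniq x : uniq (ch x) by rewrite filter_uniq ?fset_uniq.
have mem_ch x y : (y \in ch x) = (y != r) && (par y == x).
  by rewrite mem_filter memN adjE; case: ((y != r) && _) => //=; rewrite orbT.
have permN x : perm_eq (N x) (if x == r then ch x else par x :: ch x).
  apply: uniq_perm; first exact: fset_uniq.
    case: eqVneq => //= xr; rewrite ch_uniq andbT mem_ch.
    (* If [par x] were also a child of [x], each would be strictly deeper than the other. *)
    apply/negP => /andP[pr /eqP ppx].
    by have := dpar _ pr; rewrite ppx ltnNge ltnW ?dpar.
  move=> y; rewrite memN adjE.
  by case: eqVneq => [->|xr] /=; rewrite ?inE mem_ch // [par x == y]eq_sym.
have degE x : degree x = tree_degree r ch x.
  rewrite /degree /tree_degree; have /perm_size := permN x; rewrite /N => ->.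
  by case: eqVneq => _; rewrite ?addn0 ?addn1.
have deg3 x : (2 < tree_degree r ch x)%N by rewrite -degE.
have [phi [bal inj surj]] := exists_balanced_bijection dpar ch_uniq mem_ch deg3.
exists phi; split=> // x.
have sumE : \sum_(y <- N x) phi y = (degree x)%:Z * phi x.
  rewrite (perm_big _ (permN x)) degE /=; have := bal x.
  rewrite /balanced /child_sum; case: eqVneq => xr.
    by rewrite mul0r subr0.
  by rewrite mul1r big_cons => ->; rewrite addrC subrK.
rewrite fsbig_finite //= -[\sum_(_ <- _) _](rmorph_sum _ (N x)) /=.
have D0 : (degree x)%:Q != 0 by rewrite intr_eq0; have := T_deg x; lia.
by rewrite sumE rmorphM /= mulKf.
Qed.
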